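(* Let $\Delta$ be a $(d-1)$-dimensional simplicial complex with a reciprocal $h$-vector, i.e. $h_i(\Delta)=h_{d-i}(\Delta)$ for $0\le i\le d$. Then $\mathrm{Int}(\Delta)$ also has a reciprocal $h$-vector, i.e. $h_i(\mathrm{Int}(\Delta))=h_{d-i}(\mathrm{Int}(\Delta))$ for $0\le i\le d$.
   Context: Simplicial complexes are finite abstract simplicial complexes on a ground set $[n]$, containing the empty face $\emptyset$ (of dimension $-1$). For a $(d-1)$-dimensional $\Delta$, $f_i(\Delta)$ is the number of $i$-dimensional faces ($f_{-1}(\Delta)=1$), and $h_k(\Delta)=\sum_{i=0}^{k}(-1)^{k-i}\binom{d-i}{k-i}f_{i-1}(\Delta)$ for $0\le k\le d$. Interval subdivision: let $I(\Delta\setminus\{\emptyset\})=\{[A,B] : \emptyset\ne A\subseteq B\in\Delta\}$, partially ordered by $[A,B]\subseteq[A',B']$ iff $A'\subseteq A\subseteq B\subseteq B'$. $\mathrm{Int}(\Delta)$ is the simplicial complex on the ground set $I(\Delta\setminus\{\emptyset\})$ whose faces are all chains of this poset; it is again $(d-1)$-dimensional. *)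

(* Defs.v *)
From HB Require Import structures.
From mathcomp Require Import all_boot all_order all_algebra.

Set Implicit Arguments.
Unset Strict Implicit.
Unset Printing Implicit Defensive.

Import GRing.Theory.
Local Open Scope ring_scope.

(* A complex is the set of its faces. The points of T need not all be vertices,
   and the void complex (no face at all) is excluded. *)
Definition simplicial_complex (T : finType) (D : {set {set T}}) : Prop :=
  set0 \in D /\ (forall F G : {set T}, F \in D -> G \subset F -> G \in D).

Definition face_dim (T : finType) (F : {set T}) : int := #|F|%:Z - 1.

(* 1 + the dimension of D, i.e. d for a (d-1)-dimensional complex. *)
Definition rank_complex (T : finType) (D : {set {set T}}) : nat :=
  (\max_(F in D) #|F|)%N.

Definition dim_complex (T : finType) (D : {set {set T}}) : int :=
  (rank_complex D)%:Z - 1.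

Definition f_num (T : finType) (D : {set {set T}}) (i : int) : nat :=
  #|[set F in D | face_dim F == i]|.

(* For k <= rank_complex D, the nat subtractions below are never truncated. *)
Definition h_num (T : finType) (D : {set {set T}}) (k : nat) : int :=
  \sum_(0 <= i < k.+1)
    (-1) ^+ (k - i) * ('C(rank_complex D - i, k - i))%:Z
      * (f_num D (i%:Z - 1))%:Z.

(* The interval [A, B] is encoded by its pair of endpoints (A, B). *)
Definition intervals (T : finType) (D : {set {set T}}) :
    {set {set T} * {set T}} :=
  [set I : {set T} * {set T} | [&& I.1 != set0, I.1 \subset I.2 & I.2 \in D]].

Definition interval_le (T : finType) (I J : {set T} * {set T}) : bool :=
  [&& J.1 \subset I.1, I.1 \subset I.2 & I.2 \subset J.2].

Definition interval_subdivision (T : finType) (D : {set {set T}}) :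
    {set {set ({set T} * {set T})}} :=
  [set C : {set ({set T} * {set T})} | (C \subset intervals D) &&
    [forall I in C, forall J in C, interval_le I J || interval_le J I]].

Lemma interval_subdivision_complex (T : finType) (D : {set {set T}}) :
  simplicial_complex (interval_subdivision D).
Proof.
split=> [|C C']; rewrite !inE.
  by rewrite sub0set; apply/forall_inP=> I; rewrite inE.
case/andP=> sCD /forall_inP chC sC'C; rewrite (subset_trans sC'C sCD) /=.
apply/forall_inP=> I /(subsetP sC'C) CI; apply/forall_inP=> J /(subsetP sC'C).
by move: J; apply/forall_inP/chC.
Qed.

(* Main.v *)
Require Import Defs.
From HB Require Import structures.
From mathcomp Require Import all_boot all_order all_algebra.
From mathcomp Require Import zify ring.

Set Implicit Arguments.
Unset Strict Implicit.
Unset Printing Implicit Defensive.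

Import GRing.Theory.
Local Open Scope ring_scope.

(** The symmetry of an h-vector is a reflection identity for a counting
    polynomial, and the counting polynomials of a complex and of its interval
    subdivision are related by a difference equation that respects reflection.

    Let K have rank d, let f_K(t) be the sum of t^|F| over the faces F, and let
    g_K(m) be the sum of binomial(m, |C|) over the faces C. For an order complex,
    g_K(m) counts the multichains of length m in the poset with a bottom element
    adjoined. In terms of the h-vector,
      f_K(t) = sum_i h_i t^i (1 + t)^(d - i)               ([f_poly_h]),
      g_K(m) = sum_i h_i binomial(m + d - i, d)            ([multichain_count_h]),
    the second because g_K(m) is the coefficient of t^m in f_K(t) (1 + t)^m.
    Hence a symmetric h-vector gives f_K(-1 - t) = (-1)^d f_K(t)
    ([f_poly_reflect]). Conversely, since binomial(m + d - i, d) is a polynomial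
    in m that -1 - m turns into (-1)^d binomial(m + i, d), and since these
    functions of m are linearly independent, g_K(-1 - m) = (-1)^d g_K(m) forces
    the h-vector to be symmetric ([h_palindromic]).

    For K = Int(D), removing the top J of a chain of a poset gives the recurrence
      g(m + 1) = g(m) + sum_J (the same count in the part strictly below J)
    ([multichain_countS]). When J = [A, B], the part below J contributes
    (2m + 1)^|B \ A|, by induction on m ([multichain_count_below]). Summing over
    the nonempty subsets A of each B in D yields
      g(m + 1) - g(m) = f_D(2m + 2) - f_D(2m + 1)          ([multichain_count_intS]).
    It holds for all natural m, so it is an identity of polynomials and holds for
    negative m as well. The substitution of -2 - m for m exchanges the two terms
    on the right, up to sign, by the reflection of f_D; with g(0) = 1 and
    g(-1) = f_D(-1) = (-1)^d, the reflection of g follows by induction on m.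
    Int(D) has the same rank as D ([rank_interval_subdivision]), so both
    reflections involve the same d. *)

(** * Multichains of a finite poset *)

(** When K is an order complex, [binomial(m, |C|)] is the number of ways to insert
    repetitions into the chain C, preceded by copies of an adjoined bottom
    element, so as to get a multichain of length m; whence the name. *)
Definition multichain_count (T : finType) (K : {set {set T}}) (m : nat) : nat :=
  (\sum_(C in K) 'C(m, #|C|))%N.

Definition order_complex (T : finType) (le : rel T) (S : {set T}) :
    {set {set T}} :=
  [set C : {set T} | (C \subset S) &&
    [forall x in C, forall y in C, le x y || le y x]].

Definition below (T : finType) (le : rel T) (S : {set T}) (y : T) : {set T} :=
  [set x in S | (x != y) && le x y].

Lemma order_complexP (T : finType) (le : rel T) (S C : {set T}) :
  reflect (C \subset S /\ {in C &, forall x y, le x y || le y x})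
          (C \in order_complex le S).
Proof.
rewrite inE; apply: (iffP andP) => -[sCS chC]; split=> //.
  by move=> x y Cx Cy; have /forall_inP/(_ y Cy) := forall_inP chC x Cx.
by apply/forall_inP=> x Cx; apply/forall_inP=> y Cy; apply: chC.
Qed.

Lemma multichain_count0 (T : finType) (le : rel T) (S : {set T}) :
  multichain_count (order_complex le S) 0 = 1%N.
Proof.
rewrite /multichain_count (bigD1 set0) /=; last first.
  by apply/order_complexP; split=> [|x y]; rewrite ?sub0set ?inE.
rewrite cards0 bin0 big1 // => C /andP[_ nzC].
by rewrite bin0n cards_eq0 (negPf nzC).
Qed.

(** The element of C with the largest down-set in C is the greatest one: if x were
    not below it, then it would be below x, and the down-set of x would also
    contain x. *)
Lemma chain_top (T : finType) (le : rel T) (C : {set T}) :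
    antisymmetric le -> transitive le ->
    {in C &, forall x y, le x y || le y x} -> C != set0 ->
  exists2 y, y \in C & forall z, (z \in C) && [forall x in C, le x z] = (z == y).
Proof.
move=> le_asym le_tr chC /set0Pn[x0 Cx0].
pose down z := [set x in C | le x z].
case: (arg_maxnP (fun z => #|down z|) Cx0) => y Cy ymax.
have topy : {in C, forall x, le x y}.
  move=> x Cx; case/orP: (chC x y Cx Cy) => // le_yx.
  have sdown : down y \subset down x.
    by apply/subsetP=> z; rewrite !inE => /andP[-> /le_tr]; apply.
  have /eqP eq_down : down y == down x by rewrite eqEcard sdown; apply: ymax.
  have : x \in down x by rewrite inE Cx -[le x x]orbb chC.
  by rewrite -eq_down inE => /andP[].
exists y => // z; apply/andP/eqP => [[Cz /forall_inP topz]|->].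
  by apply: le_asym; rewrite topy // topz.
by split=> //; apply/forall_inP.
Qed.

(** Removing y matches the chains with top y to the chains strictly below y. *)
Lemma sum_chains_with_top (T : finType) (le : rel T) (S : {set T}) (m : nat)
    (y : T) :
    {in S, reflexive le} -> y \in S ->
  (\sum_(C in order_complex le S | (y \in C) && [forall x in C, le x y])
      'C(m, #|C|.-1))%N =
  multichain_count (order_complex le (below le S y)) m.
Proof.
move=> le_refl Sy.
rewrite (reindex_onto (fun C => y |: C) (fun C => C :\ y)) /=; last first.
  by move=> C /andP[_ /andP[Cy _]]; rewrite setD1K.
apply: eq_big => [C | C /andP[_ /eqP defC]]; last first.
  by rewrite cardsU1 -{1}defC setD11.
apply/idP/order_complexP => [|[/subsetP sCS chC]].
  case/andP=> [/andP[/order_complexP[/subsetP sCS chC] /andP[_ /forall_inP topy]]].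
  move=> /eqP defC; split=> [|x z Cx Cz]; last by rewrite chC ?inE ?Cx ?Cz ?orbT.
  apply/subsetP=> x Cx.
  have x'y : x != y by move: Cx; rewrite -{1}defC !inE => /andP[].
  by rewrite inE x'y sCS ?topy // !inE Cx orbT.
have leCy x : x \in C -> le x y by move/sCS; rewrite inE => /and3P[].
have nCy : y \notin C by apply/negP=> /sCS; rewrite inE eqxx andbF.
rewrite setU1K // eqxx andbT !inE eqxx /=; apply/andP; split; last first.
  by apply/forall_inP=> x /setU1P[->|/leCy//]; apply: le_refl.
apply/andP; split.
  apply/subsetP=> x /setU1P[->//|/sCS]; by rewrite inE => /andP[].
apply/forall_inP=> x /setU1P[->|Cx]; apply/forall_inP=> z /setU1P[->|Cz].
- by rewrite le_refl.
- by rewrite (leCy z) ?orbT.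
- by rewrite (leCy x).
- exact: chC.
Qed.

(** Pascal's rule on each nonempty chain C: binomial(m, |C|) stays in the count for
    S, and binomial(m, |C| - 1) is charged to the top of C. *)
Lemma multichain_countS (T : finType) (le : rel T) (S : {set T}) (m : nat) :
    antisymmetric le -> transitive le -> {in S, reflexive le} ->
  multichain_count (order_complex le S) m.+1 =
    (multichain_count (order_complex le S) m
     + \sum_(y in S) multichain_count (order_complex le (below le S y)) m)%N.
Proof.
move=> le_asym le_tr le_refl.
under eq_bigr => y Sy do rewrite -sum_chains_with_top //.
rewrite (exchange_big_dep [in order_complex le S]) /=; last first.
  by move=> y C _ /andP[].
rewrite /multichain_count -big_split /=; apply: eq_bigr => C KC.
have /order_complexP[/subsetP sCS chC] := KC.
have [-> | nzC] := eqVneq C set0.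
  by rewrite cards0 !bin0 big_pred0 ?addn0 // => y; rewrite in_set0 !andbF.
have [y Cy top_y] := chain_top le_asym le_tr chC nzC.
rewrite (big_pred1 y) => [|z]; last first.
  rewrite /= -top_y KC /=; by case: (boolP (z \in C)) => [/sCS->|]; rewrite ?andbF.
by case: #|C| (cards_eq0 C) => [|k _]; [rewrite (negPf nzC) | rewrite binS].
Qed.

Lemma below_below (T : finType) (le : rel T) (S : {set T}) (x y : T) :
    antisymmetric le -> transitive le -> x \in below le S y ->
  below le (below le S y) x = below le S x.
Proof.
move=> le_asym le_tr; rewrite inE => /and3P[_ x'y le_xy].
apply/setP=> z; rewrite !inE; case: (z \in S) => //=.
case: (boolP (le z x)) => [le_zx|]; rewrite ?andbF // !andbT.
rewrite (le_tr _ _ _ le_zx le_xy) andbT andbC.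
case: eqVneq => //= z'x; apply: contraNneq z'x => def_z.
by apply/eqP/le_asym; rewrite le_zx def_z le_xy.
Qed.

(** * Multichains of intervals *)
Lemma sum_subset_exp (T : finType) (E : {set T}) (x : nat) :
  (\sum_(X : {set T} | X \subset E) x ^ #|X| = x.+1 ^ #|E|)%N.
Proof.
have -> : (x.+1 ^ #|E| = \prod_i ((if i \in E then x else 0) + 1))%N.
  rewrite (bigID [in E]) /= [X in (_ * X)%N]big1 ?muln1; last first.
    by move=> i /negPf->.
  by rewrite -prod_nat_const; apply: eq_bigr => i ->; rewrite addn1.
rewrite bigA_distr [RHS](bigID (fun X : {set T} => X \subset E)) /=.
rewrite [X in (_ + X)%N]big1 ?addn0.
  apply: eq_bigr => X sXE; rewrite -prod_nat_const [LHS]big_mkcond.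
  by apply: eq_bigr => i _; case: ifP => // /(subsetP sXE)->.
move=> X /subsetPn[i Xi nEi].
by rewrite (bigD1 i) //= Xi (negPf nEi).
Qed.

Lemma sum_between_expl (T : finType) (A B : {set T}) (x : nat) : A \subset B ->
  (\sum_(X : {set T} | (A \subset X) && (X \subset B)) x ^ #|B :\: X| =
   x.+1 ^ #|B :\: A|)%N.
Proof.
move=> sAB; rewrite -sum_subset_exp.
rewrite (reindex_onto (fun X => B :\: X) (fun X => B :\: X)) /=; last first.
  by move=> X /andP[_ sXB]; rewrite setDDr setDv set0U; apply/setIidPr.
apply: eq_big => [X|X /andP[_ /eqP->//]].
rewrite subsetDl andbT; apply/andP/idP => [[sAX /eqP <-]|].
  by rewrite setDS.
rewrite subsetD => /andP[sXB dXA]; split.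
  by rewrite subsetD sAB disjoint_sym.
by rewrite setDDr setDv set0U (setIidPr sXB).
Qed.

Lemma sum_between_expr (T : finType) (A B : {set T}) (x : nat) : A \subset B ->
  (\sum_(X : {set T} | (A \subset X) && (X \subset B)) x ^ #|X :\: A| =
   x.+1 ^ #|B :\: A|)%N.
Proof.
move=> sAB; rewrite -sum_subset_exp.
rewrite (reindex_onto (fun X => A :|: X) (fun X => X :\: A)) /=; last first.
  by move=> X /andP[sAX _]; rewrite setDE setUIr setUCr setIT; apply/setUidPr.
apply: eq_big => [X|X /andP[_ /eqP->//]].
rewrite subsetUl subUset sAB /= subsetD setDUl setDv set0U.
congr (_ && _); rewrite disjoints_subset; apply/eqP/subsetP => [<- y|sXA].
  by rewrite !inE => /andP[].
apply/setP=> y; rewrite inE andbC; case Xy: (y \in X) => //=.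
by have:= sXA y Xy; rewrite inE.
Qed.

Lemma sum_subintervals_exp (T : finType) (A B : {set T}) (x : nat) :
    A \subset B ->
  (\sum_(I : {set T} * {set T} | interval_le I (A, B)) x ^ #|I.2 :\: I.1| =
   x.+2 ^ #|B :\: A|)%N.
Proof.
move=> sAB; rewrite -sum_between_expl //.
under [RHS]eq_bigr => X /andP[_ sXB] do rewrite -sum_between_expr //.
rewrite pair_big_dep /=; apply: eq_bigl => -[X Y] /=.
rewrite /interval_le /=; case: (boolP (A \subset X)) => //= _.
by apply/andP/and3P => [[sXY sYB]|[_ -> ->] //]; rewrite (subset_trans sXY).
Qed.

Lemma interval_le_asym (T : finType) : antisymmetric (@interval_le T).
Proof.
move=> [A B] [A' B'] /andP[/and3P[/= s1 _ s2] /and3P[/= s3 _ s4]].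
by congr pair; apply/eqP; rewrite eqEsubset ?s1 ?s2 ?s3.
Qed.

Lemma interval_le_trans (T : finType) : transitive (@interval_le T).
Proof.
move=> [A B] [A' B'] [A1 B1] /and3P[/= s1 s2 s3] /and3P[/= s4 _ s6].
by rewrite /interval_le /= s2 (subset_trans s4 s1) (subset_trans s3 s6).
Qed.

Lemma interval_le_refl (T : finType) (D : {set {set T}}) :
  {in intervals D, reflexive (@interval_le T)}.
Proof. by move=> [A B]; rewrite inE /interval_le !subxx => /and3P[_ ->]. Qed.

(** The intervals below [A, B] all belong to D, so only B \ A matters. By
    [multichain_countS] the step from m to m + 1 sums the count over all intervals
    contained in [A, B], the top included, and this sum is evaluated by
    [sum_subintervals_exp]; that turns 2m + 1 into 2m + 3. *)
Lemma multichain_count_below (T : finType) (D : {set {set T}}) (m : nat)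
    (J : {set T} * {set T}) :
    simplicial_complex D -> J \in intervals D ->
  multichain_count
    (order_complex (@interval_le T) (below (@interval_le T) (intervals D) J)) m =
  (m.*2.+1 ^ #|J.2 :\: J.1|)%N.
Proof.
move=> [_ Dsub].
have asym := @interval_le_asym T; have tr := @interval_le_trans T.
elim: m J => [|m IHm] [A B] DJ; first by rewrite multichain_count0 exp1n.
rewrite multichain_countS // => [|I]; last first.
  by rewrite inE => /andP[/interval_le_refl-> _].
rewrite IHm //=.
under eq_bigr => I lIJ.
  rewrite below_below // IHm; last by move: lIJ; rewrite inE => /andP[].
  over.
move: (DJ); rewrite inE => /and3P[/= nzA sAB DB].
rewrite doubleS -sum_subintervals_exp // [RHS](bigD1 (A, B)) /=; last first.
  exact: interval_le_refl DJ.
congr (_ + _)%N; apply: eq_bigl => -[X Y].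
rewrite !inE andbCA [in RHS]andbC; case: (_ != _) => //=.
apply/andP/idP => [[]//|lIJ]; split=> //.
case/and3P: lIJ => /= sAX sXY sYB; rewrite sXY (Dsub B) // !andbT.
by apply: contraNneq nzA => X0; rewrite -subset0 -X0.
Qed.

(** The terms with top [A, F] add up to (2m + 2)^|F| - (2m + 1)^|F|, the subtracted
    term being the one that A = set0 would contribute. The identity is stated
    without subtraction because it lives in nat. *)
Lemma multichain_count_intS (T : finType) (D : {set {set T}}) (m : nat) :
    simplicial_complex D ->
  (multichain_count (interval_subdivision D) m.+1
     + \sum_(F in D) m.*2.+1 ^ #|F| =
   multichain_count (interval_subdivision D) m
     + \sum_(F in D) m.*2.+2 ^ #|F|)%N.
Proof.
move=> complexD; have [_ Dsub] := complexD.
rewrite -[interval_subdivision D]/(order_complex (@interval_le T) (intervals D)).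
rewrite multichain_countS; first 1 last.
- exact: interval_le_asym.
- exact: interval_le_trans.
- exact: interval_le_refl.
rewrite -addnA; congr (_ + _)%N.
under eq_bigr => J DJ do rewrite multichain_count_below //.
have -> : (\sum_(J in intervals D) m.*2.+1 ^ #|J.2 :\: J.1| =
  \sum_(F in D) \sum_(A : {set T} | (A != set0) && (A \subset F))
     m.*2.+1 ^ #|F :\: A|)%N.
  rewrite pair_big_dep /= (reindex_onto (fun p => (p.2, p.1)) (fun p => (p.2, p.1))).
    by apply: eq_bigl => -[F A]; rewrite !inE /= eqxx andbT [RHS]andbC andbA.
  by case.
rewrite -big_split; apply: eq_bigr => F DF /=.
rewrite -[F in RHS]setD0 -sum_between_expl ?sub0set //.
rewrite [RHS](bigD1 set0) ?sub0set //= addnC setD0; congr (_ + _)%N.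
by apply: eq_bigl => A; rewrite sub0set andbC.
Qed.

(** * The rank of the interval subdivision *)

(** Along a chain of intervals [A, B] the cardinal of B \ A strictly increases, and
    it is smaller than the rank of D since A is not empty. *)
Lemma rank_int_le (T : finType) (D : {set {set T}}) :
  (rank_complex (interval_subdivision D) <= rank_complex D)%N.
Proof.
apply/bigmax_leqP => C /order_complexP[/subsetP sCS chC].
pose gap (I : {set T} * {set T}) := #|I.2 :\: I.1|.
have gap_inj : {in C &, injective gap}.
  suff gap_le I J : interval_le I J -> gap I = gap J -> I = J.
    move=> I J CI CJ eq_gap; case/orP: (chC I J CI CJ) => le_IJ.
      exact: gap_le.
    by apply/esym/gap_le.
  case: I J => [A B] [A' B'] /and3P[/= sA'A sAB sBB'] eq_gap.
  have sD : B :\: A \subset B' :\: A' by apply: setDSS.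
  have /eqP eqD : B :\: A == B' :\: A'.
    by rewrite eqEcard sD -/(gap (A', B')) -eq_gap /=.
  have eqA : A = A'.
    apply/eqP; rewrite eqEsubset sA'A andbT; apply/subsetP=> x Ax.
    have : x \notin B' :\: A' by rewrite -eqD inE Ax.
    by rewrite inE (subsetP sBB') ?(subsetP sAB) // andbT negbK.
  have eqB : B = B'.
    apply/eqP; rewrite eqEsubset sBB'; apply/subsetP=> x B'x.
    case: (boolP (x \in A)) => [/(subsetP sAB)//|nAx].
    have : x \in B' :\: A' by rewrite inE -eqA nAx.
    by rewrite -eqD inE => /andP[].
  by rewrite eqA eqB.
rewrite cardE -(size_map gap) -(size_iota 0 (rank_complex D)).
apply: uniq_leq_size.
  rewrite map_inj_in_uniq ?enum_uniq // => I J; rewrite !mem_enum.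
  exact: gap_inj.
move=> k /mapP[[A B]]; rewrite mem_enum => /sCS.
rewrite inE => /and3P[/= nzA sAB DB] ->.
rewrite mem_iota /=; apply: leq_trans (leq_bigmax_cond _ DB); apply: proper_card.
rewrite properE subsetDl; have /set0Pn[x Ax] := nzA.
by apply/subsetPn; exists x; rewrite ?inE ?Ax ?(subsetP sAB).
Qed.

(** A face with elements x_0, ..., x_(k-1) carries the chain of the k intervals
    [{x_0}, {x_0, ..., x_i}]. *)
Lemma rank_int_ge (T : finType) (D : {set {set T}}) : simplicial_complex D ->
  (rank_complex D <= rank_complex (interval_subdivision D))%N.
Proof.
move=> [_ Dsub]; apply/bigmax_leqP => F DF.
case Fs: (enum F) (enum_uniq F) => [|x s]; first by rewrite cardE Fs.
move=> uxs; rewrite cardE Fs /=.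
pose B i : {set T} := [set y in x :: take i s].
pose I_ (i : 'I_(size s).+1) := ([set x], B i).
have inxs i y : y \in x :: take i s -> y \in F.
  rewrite -mem_enum Fs !inE; case: eqP => //= _; exact: mem_take.
have ux i : uniq (x :: take i s).
  by have:= take_uniq i.+1 uxs.
have cardB i : (i <= size s)%N -> #|B i| = i.+1.
  move=> les; rewrite /B cardsE (card_uniqP _) // /= size_takel //.
have injI : injective I_.
  move=> i j [eqB]; apply/val_inj; have := congr1 (fun X : {set T} => #|X|) eqB.
  by rewrite !cardB -1?ltnS // => -[].
have sBB i j : (i <= j)%N -> B i \subset B j.
  move=> le_ij; apply/subsetP=> y; rewrite !inE; case: eqP => //= _.
  by rewrite -(subnKC le_ij) takeD mem_cat => ->.
apply: (bigmax_sup [set I_ i | i : 'I_(size s).+1]); last first.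
  by rewrite card_imset // card_ord.
apply/order_complexP; split.
  apply/subsetP=> _ /imsetP[i _ ->]; rewrite inE /=; apply/and3P; split.
  - by apply/set0Pn; exists x; rewrite inE.
  - by rewrite sub1set !inE eqxx.
  - by apply: (Dsub F) => //; apply/subsetP=> y; rewrite inE; apply: inxs.
move=> _ _ /imsetP[i _ ->] /imsetP[j _ ->]; rewrite /interval_le /= !subxx /=.
have xB k : [set x] \subset B k by rewrite sub1set !inE eqxx.
by rewrite !xB /=; case/orP: (leq_total i j) => /sBB->; rewrite ?orbT.
Qed.

Lemma rank_interval_subdivision (T : finType) (D : {set {set T}}) :
  simplicial_complex D -> rank_complex (interval_subdivision D) = rank_complex D.
Proof. by move=> cD; apply/eqP; rewrite eqn_leq rank_int_le rank_int_ge. Qed.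

(** * The f- and h-vectors as expansions of one polynomial *)

(** The change of basis from the h-vector back to the f-vector: after exchanging
    the sums, the coefficient of a_j is X^j times the binomial expansion of
    ((1 + X) - X)^(d - j) = 1. *)
Lemma h_inversion (a : nat -> int) (d : nat) :
  \sum_(j < d.+1) a j *: 'X^j =
  \sum_(k < d.+1)
    (\sum_(0 <= j < k.+1) (-1) ^+ (k - j) * ('C(d - j, k - j))%:Z * a j)
      *: ('X^k * (1 + 'X) ^+ (d - k)) :> {poly int}.
Proof.
pose c k j : int := (-1) ^+ (k - j) * ('C(d - j, k - j))%:Z * a j.
under [RHS]eq_bigr => k _.
  rewrite big_mkord (big_ord_widen _ (c k) (ltn_ord k)) scaler_suml.
  over.
rewrite (exchange_big_dep xpredT) //=; apply: eq_bigr => j _.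
have le_jd : (j <= d)%N by rewrite -ltnS.
(* Insert the sum of the coefficients of a_j as a power of 1 = (1 + X) - X. *)
transitivity (a j *: ('X^j * ((1 + 'X) - 'X) ^+ (d - j)) : {poly int}).
  by rewrite addrK expr1n mulr1.
rewrite -[RHS](big_geq_mkord _ _ xpredT
  (fun k => c k j *: ('X^k * (1 + 'X) ^+ (d - k)))) /=.
rewrite -[X in \sum_(X <= _ < _ | _) _]add0n big_addn big_mkord subSn //.
rewrite exprDn mulr_sumr scaler_sumr.
apply: eq_bigr => l _; rewrite /c addnK addnC -subnDA exprD.
rewrite -!mul_polyC -mulr_natr -[- (_ : {poly int})]mulN1r exprMn -!natz.
rewrite !rmorphM /= !rmorphXn /= !rmorph_nat !rmorphN1.
ring.
Qed.

Definition f_poly (T : finType) (D : {set {set T}}) : {poly int} :=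
  \sum_(F in D) 'X^#|F|.

Lemma horner_f_poly (T : finType) (D : {set {set T}}) (x : int) :
  (f_poly D).[x] = \sum_(F in D) x ^+ #|F|.
Proof. by rewrite horner_sum; apply: eq_bigr => F _; rewrite hornerXn. Qed.

Lemma f_poly_h (T : finType) (D : {set {set T}}) (d : nat) :
    rank_complex D = d ->
  f_poly D = \sum_(k < d.+1) h_num D k *: ('X^k * (1 + 'X) ^+ (d - k)).
Proof.
move=> rkD; have := h_inversion (fun j => (f_num D (j%:Z - 1))%:Z) d.
rewrite /h_num rkD => <-; rewrite /f_poly.
have szF F : F \in D -> (#|F| < d.+1)%N.
  by move=> DF; rewrite ltnS -rkD; apply: leq_bigmax_cond.
rewrite (partition_big (fun F : {set T} => inord #|F| : 'I_d.+1) predT) //=.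
apply: eq_bigr => j _.
rewrite (eq_bigr (fun=> 'X^j)) => [|F /andP[/szF szF' /eqP <-]]; last first.
  by rewrite inordK.
rewrite sumr_const -scaler_nat natz; congr (Posz _ *: _).
rewrite /f_num; apply: eq_card => F; rewrite !inE unfold_in /=.
case: (boolP (F \in D)) => //= /szF szF'; rewrite /face_dim.
rewrite (inj_eq (addIr _)) -val_eqE /= inordK //.
Qed.

(** At -1 - x, the factors x and 1 + x of each term of [f_poly_h] are exchanged, up
    to sign. *)
Lemma f_poly_reflect (T : finType) (D : {set {set T}}) (d : nat) (x : int) :
    rank_complex D = d ->
    (forall i : nat, (i <= d)%N -> h_num D i = h_num D (d - i)%N) ->
  (f_poly D).[- 1 - x] = (-1) ^+ d * (f_poly D).[x].
Proof.
move=> rkD hsym; rewrite (f_poly_h rkD) !horner_sum mulr_sumr.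
rewrite [RHS](reindex_inj rev_ord_inj) /=; apply: eq_bigr => i _.
have le_id : (i <= d)%N by rewrite -ltnS.
rewrite !(hornerZ, hornerM, horner_exp, hornerD, hornerC, hornerX).
rewrite subSS -hsym // subKn //.
have -> : - 1 - x = - 1 * (1 + x) by ring.
have -> : 1 + - 1 * (1 + x) = - 1 * x by ring.
rewrite !exprMn -[in (-1) ^+ d](subnKC le_id) exprD; ring.
Qed.

(** Both sides are the coefficient of X^m in f_poly K * (1 + X)^m, expanded along
    the faces on the left and along [f_poly_h] on the right. *)
Lemma multichain_count_h (T : finType) (K : {set {set T}}) (d m : nat) :
    rank_complex K = d ->
  (multichain_count K m)%:Z =
    \sum_(i < d.+1) h_num K i * ('C(m + (d - i), d))%:Z.
Proof.
move=> rkK.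
transitivity (f_poly K * (1 + 'X) ^+ m)`_m.
  rewrite mulr_suml coef_sum -natz natr_sum; apply: eq_bigr => C _.
  rewrite coefXnM exprDn; case: ltnP => [/bin_small-> //|le_Cm].
  rewrite coef_sum (bigD1 (Ordinal (leq_subr #|C| m : _ < m.+1)%N)) //=.
  rewrite coefMn expr1n mul1r coefXn eqxx bin_sub // natz big1 ?addr0 // => i.
  by rewrite -val_eqE /= expr1n mul1r coefMn coefXn eq_sym => /negPf->; rewrite mul0rn.
rewrite (f_poly_h rkK) mulr_suml coef_sum; apply: eq_bigr => i _.
have le_id : (i <= d)%N by rewrite -ltnS.
rewrite -scalerAl coefZ -mulrA -exprD coefXnM; congr (_ * _).
case: ltnP => [lt_mi|le_im]; first by rewrite bin_small //; lia.
have lt_mi : (m - i < (d - i + m).+1)%N by lia.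
rewrite exprDn coef_sum (bigD1 (Ordinal lt_mi)) //= big1 ?addr0 => [|j].
  rewrite coefMn expr1n mul1r coefXn eqxx natz -bin_sub; last lia.
  congr (Posz 'C(_, _)); lia.
by rewrite -val_eqE /= expr1n mul1r coefMn coefXn eq_sym => /negPf->; rewrite mul0rn.
Qed.

(** * Reflection of the multichain polynomial *)
Definition ffact_poly (d : nat) : {poly int} := \prod_(i < d) ('X - (i%:Z)%:P).

Lemma horner_ffact_poly (d m : nat) : (ffact_poly d).[m%:Z] = (m ^_ d)%:Z.
Proof.
rewrite horner_prod ffact_prod -[RHS]natz natr_prod.
have [le_dm | lt_md] := leqP d m.
  by apply: eq_bigr => i _; rewrite !hornerE natz subzn // ltnW // (leq_trans _ le_dm).
rewrite (bigD1 (Ordinal lt_md)) //= [RHS](bigD1 (Ordinal lt_md)) //=.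
by rewrite !hornerE subrr subnn !mul0r.
Qed.

Lemma ffact_poly_reflect (d : nat) (x : int) :
  (ffact_poly d).[d%:Z - 1 - x] = (-1) ^+ d * (ffact_poly d).[x].
Proof.
rewrite !horner_prod -[in X in _ ^+ X](card_ord d) -prodrN.
rewrite (reindex_inj rev_ord_inj) /=; apply: eq_bigr => i _; rewrite !hornerE.
have := ltn_ord i; lia.
Qed.

Lemma poly_vanish_nat (p : {poly int}) :
  (forall m : nat, p.[m%:Z] = 0) -> p = 0.
Proof.
move=> p0; apply: (@roots_geq_poly_eq0 _ p [seq m%:Z | m <- iota 0 (size p)]).
- by apply/allP=> _ /mapP[m _ ->]; rewrite /root p0.
- by rewrite map_inj_uniq ?iota_uniq // => m n [].
- by rewrite size_map size_iota.
Qed.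

(** The system is triangular: at m = i, the terms of index j > i vanish because
    m + (d - j) < d, and the term of index i has coefficient 1. *)
Lemma binomial_basis_free (d : nat) (u : nat -> int) :
    (forall m : nat, \sum_(i < d.+1) u i * ('C(m + (d - i), d))%:Z = 0) ->
  forall i, (i <= d)%N -> u i = 0.
Proof.
move=> sum0 i; elim/ltn_ind: i => i IHi le_id.
have := sum0 i; rewrite (bigD1 (Ordinal (le_id : i < d.+1)%N)) //= big1 => [|j].
  by rewrite addr0 subnKC // binn mulr1.
rewrite -val_eqE /= => neq_ij; have [lt_ji|le_ij] := ltnP j i.
  by rewrite IHi ?mul0r // -ltnS.
by rewrite bin_small ?mulr0 //; have := ltn_ord j; lia.
Qed.

(** The polynomial that interpolates d! times [multichain_count K]; the factor d!
    keeps its coefficients integral. *)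
Definition multichain_poly (T : finType) (K : {set {set T}}) : {poly int} :=
  let d := rank_complex K in
  \sum_(i < d.+1) h_num K i *: (ffact_poly d \Po ('X + ((d - i)%N%:Z)%:P)).

Lemma horner_multichain_poly (T : finType) (K : {set {set T}}) (x : int) :
  (multichain_poly K).[x] =
  \sum_(i < (rank_complex K).+1)
    h_num K i * (ffact_poly (rank_complex K)).[x + (rank_complex K - i)%N%:Z].
Proof.
by rewrite horner_sum; apply: eq_bigr => i _; rewrite hornerZ horner_comp !hornerE.
Qed.

Lemma multichain_poly_nat (T : finType) (K : {set {set T}}) (m : nat) :
  (multichain_poly K).[m%:Z] =
  ((rank_complex K)`!)%:Z * (multichain_count K m)%:Z.
Proof.
rewrite horner_multichain_poly (multichain_count_h m (erefl (rank_complex K))).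
rewrite mulr_sumr.
apply: eq_bigr => i _.
by rewrite -PoszD horner_ffact_poly -bin_ffact PoszM mulrA mulrC.
Qed.

(** By [ffact_poly_reflect], reflecting the multichain polynomial reverses,
    up to the sign (-1)^d, the h-vector in its expansion along the functions
    binomial(m + d - i, d), and this expansion is unique. *)
Lemma h_palindromic (T : finType) (K : {set {set T}}) (d : nat) :
    rank_complex K = d ->
    (forall m : nat, (multichain_poly K).[- 1 - m%:Z] =
                     (-1) ^+ d * (multichain_poly K).[m%:Z]) ->
  forall i : nat, (i <= d)%N -> h_num K i = h_num K (d - i)%N.
Proof.
move=> rkK Ksym i le_id.
apply/eqP; rewrite -subr_eq0; apply/eqP; move: i le_id.
apply: (binomial_basis_free (u := fun i => h_num K i - h_num K (d - i)%N)) => m.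
under eq_bigr do rewrite mulrBl.
rewrite sumrB; apply/eqP; rewrite subr_eq0; apply/eqP.
have fact_neq0 : (d`!)%:Z != 0 by rewrite -lt0n fact_gt0.
apply: (mulfI fact_neq0); rewrite -multichain_count_h // -{1}rkK -multichain_poly_nat.
have sgn2 (y : int) : (-1) ^+ d * ((-1) ^+ d * y) = y.
  by rewrite mulrA -expr2 sqrr_sign mul1r.
rewrite -[LHS]sgn2 -Ksym.
rewrite horner_multichain_poly rkK !mulr_sumr [RHS](reindex_inj rev_ord_inj) /=.
apply: eq_bigr => i _; have le_id : (i <= d)%N by rewrite -ltnS.
rewrite subSS !subKn //.
have -> : - 1 - m%:Z + (d - i)%N%:Z = d%:Z - 1 - (m + i)%N%:Z by lia.
rewrite ffact_poly_reflect horner_ffact_poly -bin_ffact PoszM.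
by rewrite mulrCA sgn2; ring.
Qed.

(** Both sides are polynomials in x, and they agree at the natural numbers by
    [multichain_count_intS]. *)
Lemma multichain_poly_int_step (T : finType) (D : {set {set T}}) (x : int) :
    simplicial_complex D ->
  (multichain_poly (interval_subdivision D)).[x + 1]
    - (multichain_poly (interval_subdivision D)).[x] =
  ((rank_complex D)`!)%:Z * ((f_poly D).[2 * x + 2] - (f_poly D).[2 * x + 1]).
Proof.
move=> complexD; set G := multichain_poly _; set c := Posz _.
pose p := (G \Po ('X + 1%:P)) - G - c%:P * ((f_poly D \Po (2%:P * 'X + 2%:P))
  - (f_poly D \Po (2%:P * 'X + 1%:P))).
have pE y : p.[y] = G.[y + 1] - G.[y]
     - c * ((f_poly D).[2 * y + 2] - (f_poly D).[2 * y + 1]).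
  by rewrite /p !(hornerD, hornerN, hornerM, horner_comp, hornerC, hornerX).
suff p0 : p = 0 by apply/eqP; rewrite -subr_eq0 -pE p0 horner0.
apply: poly_vanish_nat => m; rewrite pE.
have -> : m%:Z + 1 = m.+1%:Z by lia.
rewrite !multichain_poly_nat rank_interval_subdivision // -/c -!mulrBr.
rewrite -[RHS](mulr0 c); congr (_ * _).
have -> : 2 * m%:Z + 2 = (m.*2.+2)%:Z by lia.
have -> : 2 * m%:Z + 1 = (m.*2.+1)%:Z by lia.
have f_nat k : (f_poly D).[k%:Z] = (\sum_(F in D) k ^ #|F|)%N%:Z.
  rewrite horner_f_poly -[RHS]natz natr_sum; apply: eq_bigr => F _.
  by rewrite natrX natz.
by rewrite !f_nat; have := multichain_count_intS m complexD; lia.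
Qed.

Theorem corollary3p6 (n d : nat) (Delta : {set {set 'I_n}}) :
  simplicial_complex Delta ->
  dim_complex Delta = d%:Z - 1 ->
  (forall i : nat, (i <= d)%N -> h_num Delta i = h_num Delta (d - i)%N) ->
  forall i : nat, (i <= d)%N ->
    h_num (interval_subdivision Delta) i =
    h_num (interval_subdivision Delta) (d - i)%N.
Proof.
move=> complexD /addIr[rkD] hsym.
have rkI : rank_complex (interval_subdivision Delta) = d.
  by rewrite rank_interval_subdivision.
apply: h_palindromic => //.
set G := multichain_poly _.
have step x := multichain_poly_int_step x complexD; rewrite -/G rkD in step.
have reflect x := f_poly_reflect x rkD hsym.
elim=> [|m IHm].
  (* The step at x = -1 compares G(0) = d! with G(-1). *)
  have G0 : G.[0] = (d`!)%:Z.
    by rewrite multichain_poly_nat rkI multichain_count0 mulr1.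
  have f0 : (f_poly Delta).[0] = 1.
    rewrite horner_f_poly (bigD1 set0) ?(proj1 complexD) //= cards0 expr0 big1 ?addr0 //.
    by move=> F /andP[_ nzF]; rewrite expr0n cards_eq0 (negPf nzF).
  have := step (- 1); have := reflect 0; rewrite subr0 addNr G0 f0.
  have -> : (2 * - 1 + 1)%R = (- 1)%R :> int by [].
  move=> ->; rewrite !mulr1 mulrBr mulr1 => eqG.
  by apply/eqP; rewrite -subr_eq0; apply/eqP; rewrite [_ * (-1) ^+ _]mulrC in eqG; lia.
(* The steps at m and at -2 - m are exchanged by the reflection. *)
have := step m%:Z; have := step (- 1 - m.+1%:Z).
have -> : - 1 - m.+1%:Z + 1 = - 1 - m%:Z by lia.
have -> : m%:Z + 1 = m.+1%:Z by lia.
have -> : 2 * (- 1 - m.+1%:Z) + 2 = - 1 - (2 * m%:Z + 1) by lia.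
have -> : 2 * (- 1 - m.+1%:Z) + 1 = - 1 - (2 * m%:Z + 2) by lia.
rewrite !reflect IHm => eq1 eq2.
have -> : G.[- 1 - m.+1%:Z] = (-1) ^+ d * G.[m%:Z]
    - ((-1) ^+ d * G.[m%:Z] - G.[- 1 - m.+1%:Z]) by ring.
have -> : G.[m.+1%:Z] = (G.[m.+1%:Z] - G.[m%:Z]) + G.[m%:Z] by ring.
by rewrite eq1 eq2; ring.
Qed.
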